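(* Let $P(x)=R(x)-q$ be a real polynomial in $x$ of degree $n\ge 2$, with $R(0)=0$ and $q\in\mathbb{R}$. Let $x(q)$ be one of the roots of the equation $P(x)=0$, defined in a neighborhood of $0$, that tends to $0$ as $q$ tends to $0$. Then $x=x(q)$ satisfies an $(n-1)$-th order linear ODE $$b_{n-1}(q)x^{(n-1)}+b_{n-2}(q)x^{(n-2)}+\cdots+b_1(q)x'+b_0(q)x+b_n(q)=0,$$ where the functions $b_j(q)$, $j=0,1,\ldots,n$, are polynomials in $q$ with coefficients depending on the coefficients of $R$.
   Context: $R\in\mathbb{R}[x]$ is a polynomial of degree $n$ not depending on $q$. Derivatives are with respect to $q$, and $x^{(k)}$ denotes the $k$-th derivative. That the ODE is of $(n-1)$-th order means that the polynomial $b_{n-1}$ is not identically zero. The root $x(q)$ is a continuous branch of solutions, i.e. a continuous (real- or complex-valued) function of the real variable $q$ near $0$ with $R(x(q))=q$. That $x(q)$ satisfies the ODE means that the equation holds at each $q$ of its domain at which $x$ is $n-1$ times differentiable (the point $q=0$ may have to be excluded). *)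

(* Defs.v *)
From HB Require Import structures.
From mathcomp Require Import all_boot all_order all_algebra.
From mathcomp Require Import complex.
From mathcomp Require Import boolp classical_sets functions reals topology.
From mathcomp Require Import normedtype derive.

Set Implicit Arguments.
Unset Strict Implicit.
Unset Printing Implicit Defensive.

Import Order.TTheory GRing.Theory Num.Theory.
Import numFieldNormedType.Exports.

Local Open Scope classical_set_scope.
Local Open Scope ring_scope.

(* [Rcomplex K] is the field K[i] seen as a real vector space. It already
   carries the norm |a + ib| = sqrt (a^2 + b^2) with values in K; giving it the
   induced topology makes it a normed K-module, so that [derivable] and [derive1]
   apply to complex-valued functions of a real variable. *)
Section RcomplexNormedModule.
Variable K : realType.

Lemma Rcomplex_normrZ (l : K) (z : Rcomplex K) : `|l *: z| = `|l| * `|z|.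
Proof.
case: z => a b; rewrite /Num.norm /= !exprMn -mulrDr.
by rewrite sqrtrM ?sqr_ge0// sqrtr_sqr.
Qed.

HB.instance Definition _ :=
  PseudoMetric.copy (Rcomplex K) (pseudoMetric_normed (Rcomplex K)).
HB.instance Definition _ := isPointed.Build (Rcomplex K) 0.
HB.instance Definition _ :=
  NormedZmod_PseudoMetric_eq.Build K (Rcomplex K) erefl.
HB.instance Definition _ :=
  PseudoMetricNormedZmod_Lmodule_isNormedModule.Build K (Rcomplex K)
    Rcomplex_normrZ.

End RcomplexNormedModule.

(* [derive1n] is total, so existence of the derivatives is a separate
   condition: f is k+1 times differentiable at q when it is k times
   differentiable on a neighborhood of q and f^(k) is differentiable at q. *)
Fixpoint times_differentiable (K : realType) (V : normedModType K) (k : nat)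
    (f : K -> V) (q : K) : Prop :=
  if k is k'.+1 then
    (\forall p \near q, times_differentiable k' f p) /\ derivable f^`(k')%classic q 1
  else True.

(* A real-valued branch x(q) of roots of R(x) - q on the open neighborhood U of
   0, tending to 0; the values of x outside U are irrelevant. *)
Definition real_root_branch (K : realType) (R : {poly K}) (U : set K)
    (x : K -> K) : Prop :=
  [/\ open_nbhs 0 U,
      {in U, continuous x},
      forall q, U q -> root (R - q%:P) (x q)
    & x q @[q --> (0 : K)] --> (0 : K)].

Definition complex_root_branch (K : realType) (R : {poly K}) (U : set K)
    (x : K -> Rcomplex K) : Prop :=
  [/\ open_nbhs 0 U,
      {in U, continuous x},
      forall q, U q -> root (map_poly (real_complex K) (R - q%:P)) (x q)
    & x q @[q --> (0 : K)] --> (0 : Rcomplex K)].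

(* Main.v *)
(* Differentiating R(x(q)) = q gives x' = 1 / R'(x), so every derivative is
   x^(j) = N_j(x) / R'(x)^(2j) for polynomials N_j. Since K[X] has rank n over
   K[R], the n + 1 elements 1, x, x', ..., x^(n-1) are linearly dependent over
   K(q). A dependence involves some x^(k) with k < n, as 1 alone is
   independent; differentiating it n - 1 - k times brings the order to exactly
   n - 1 and preserves the leading coefficient. *)
Require Import Defs.
From HB Require Import structures.
From mathcomp Require Import all_boot all_order all_algebra.
From mathcomp Require Import complex.
From mathcomp Require Import ring zify.
From mathcomp Require Import boolp classical_sets functions reals topology.
From mathcomp Require Import normedtype derive.

Set Implicit Arguments.
Unset Strict Implicit.
Unset Printing Implicit Defensive.

Import Order.TTheory GRing.Theory Num.Theory.
Import numFieldNormedType.Exports.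

Local Open Scope classical_set_scope.
Local Open Scope ring_scope.

(** * Linear dependence over the polynomials in [R] *)

(* Dimension count: b ranges over polynomials of size at most d, so there are
   (n + 1) d unknowns, while the sum has size at most n d + c < (n + 1) d. *)
Lemma poly_comp_dependence (F : fieldType) (R : {poly F}) (n : nat)
    (M : 'I_n.+1 -> {poly F}) :
  size R = n.+1 ->
  exists b : 'I_n.+1 -> {poly F},
    (exists i, b i != 0) /\ \sum_i (b i \Po R) * M i = 0.
Proof.
move=> sR.
pose c := \max_i size (M i); pose d := c.+1; pose L := (n * d + c)%N.
pose f (B : 'M[F]_(n.+1, d)) : 'rV[F]_L :=
  poly_rV (\sum_i (rVpoly (row i B) \Po R) * M i).
have f_lin : linear f.
  move=> a A B; rewrite /f -linearP scaler_sumr -big_split /=.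
  congr poly_rV; apply: eq_bigr => i _.
  by rewrite !linearP /= mulrDl scalerAl.
pose fL := GRing.isLinear.Build _ _ _ _ f f_lin.
pose f' : {linear _ -> _} := HB.pack f fL.
pose A := lin1_mx (f' \o vec_mx).
have : kermx A != 0.
  rewrite kermx_eq0 /row_free neq_ltn; apply/orP; left.
  by rewrite (leq_ltn_trans (rank_leq_col _))// /L mulSn addnC ltn_add2r.
case/rowV0Pn => v /sub_kermxP vA v0.
pose B : 'M_(n.+1, d) := vec_mx v.
have fB : f B = 0 by move: vA; rewrite mul_rV_lin1.
have B0 : B != 0 by rewrite vec_mx_eq0.
exists (fun i => rVpoly (row i B)); split.
  have [i Bi] : exists i, row i B != 0.
    apply/existsP; apply: contraNT B0 => /existsPn Bz.
    by apply/eqP/row_matrixP => i; rewrite row0; apply/eqP; have := Bz i; rewrite negbK.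
  by exists i; apply: contraNneq Bi => Bi; rewrite -[row i B]rVpolyK Bi linear0.
(* [poly_rV] keeps only [L] coefficients, so [f B = 0] makes the sum vanish only once its size is
   bounded by [L]. *)
have := congr1 rVpoly fB; rewrite linear0 poly_rV_K//.
apply: leq_trans (size_sum _ _ _) _; apply/bigmax_leqP => i _.
have Mi : (size (M i) <= c)%N by apply: (leq_bigmax i).
have [->|M0] := eqVneq (M i) 0; first by rewrite mulr0 size_poly0.
apply: leq_trans (size_polyMleq _ _) _.
have sB : ((size (rVpoly (row i B))).-1 <= c)%N.
  have : (size (rVpoly (row i B)) <= d)%N := size_poly _ _.
  by rewrite /d; lia.
have := size_comp_poly_leq (rVpoly (row i B)) R.
have : ((size (rVpoly (row i B))).-1 * n <= c * n)%N by rewrite leq_mul2r sB orbT.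
rewrite sR -pred_Sn /L /d mulnS [(n * c)%N]mulnC.
move: (_ * n)%N (size (_ \Po _)) => u w; lia.
Qed.

(** * Differential relations as polynomial identities in x *)

Section Derivatives.
Variables (F : fieldType) (R : {poly F}).

(* The polynomials N_j with x^(j) = N_j(x) / R'(x)^(2j). *)
Fixpoint dnum (j : nat) : {poly F} :=
  if j is i.+1 then
    (dnum i)^`() * R^`() - dnum i * R^`()^`() *+ i.*2
  else 'X.

(** The numerator of x^(j) over the common denominator R'(x)^(2m), for j at most m. *)
Definition dterm (m j : nat) : {poly F} := dnum j * R^`() ^+ (m - j).*2.

(** Quotient rule for [dterm m j] over R'^(2m), with d/dq = (1/R') d/dx; the term with R'' comes
    from the denominator. *)
Lemma dterm_step m j : (j <= m)%N ->
  R^`() * (dterm m j)^`() =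
  dterm m.+1 j.+1 + R^`()^`() * dterm m j *+ m.*2.
Proof.
move=> jm; rewrite -(subnK jm); move: (m - j)%N => k.
rewrite /dterm subSS addnK derivM deriv_exp.
case: k => [|k] /=; first by rewrite add0n expr0 mulr0n; ring.
rewrite addSn !doubleS doubleD !exprS. ring.
Qed.

(* Cleared of denominators by R'(x)^(2m), the equation
   sum_j b_j(q) x^(j) + c(q) = 0 with q = R(x); b is the polynomial
   sum_j b_j 'X^j in the symbol 'X = d/dq, and only b_0, ..., b_m are read. *)
Definition ode_rel (b : {poly {poly F}}) (c : {poly F}) (m : nat) : Prop :=
  \sum_(j < m.+1) (b`_j \Po R) * dterm m j + (c \Po R) * R^`() ^+ m.*2 = 0.

(* The operator d/dq applied to sum_j b_j (d/dq)^j. *)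
Definition ode_diff (b : {poly {poly F}}) : {poly {poly F}} :=
  map_poly (@deriv F) b + b * 'X.

(** Differentiating the coefficients does not raise the degree in ['X], so [b * 'X] dominates and
    the order grows by exactly one. *)
Lemma size_ode_diff (b : {poly {poly F}}) : b != 0 -> size (ode_diff b) = (size b).+1.
Proof.
move=> b0; rewrite /ode_diff addrC size_polyDl size_mulX//.
by rewrite ltnS size_poly.
Qed.

(** Differentiate the relation in x and multiply by R'. The bound on [size b] ensures that no
    coefficient of [b] escapes the relation. *)
Lemma ode_diff_rel (b : {poly {poly F}}) (c : {poly F}) m : (size b <= m.+1)%N ->
  ode_rel b c m -> ode_rel (ode_diff b) c^`() m.+1.
Proof.
move=> sb E.
have dS (p : {poly F}) j : (j <= m)%N ->
    R^`() * ((p \Po R) * dterm m j)^`() =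
    (p^`() \Po R) * dterm m.+1 j + (p \Po R) * dterm m.+1 j.+1
    + R^`()^`() * ((p \Po R) * dterm m j) *+ m.*2.
  move=> jm; rewrite derivM mulrDr deriv_comp.
  rewrite [_ * (_ * (dterm m j)^`())]mulrCA dterm_step//.
  by rewrite /dterm subSS (subSn jm) doubleS !exprS; ring.
have dc : R^`() * ((c \Po R) * R^`() ^+ m.*2)^`() =
    (c^`() \Po R) * R^`() ^+ m.+1.*2
    + R^`()^`() * ((c \Po R) * R^`() ^+ m.*2) *+ m.*2.
  rewrite derivM deriv_comp deriv_exp doubleS.
  case: m.*2 => [|k] /=; rewrite ?mulr0n ?exprS; ring.
have H : R^`() * (\sum_(j < m.+1) (b`_j \Po R) * dterm m j
    + (c \Po R) * R^`() ^+ m.*2)^`() = 0 by rewrite E deriv0 mulr0.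
move: H; rewrite derivD mulrDr dc raddf_sum mulr_sumr.
rewrite (eq_bigr _ (fun (j : 'I_m.+1) _ => dS b`_j j (leq_ord j))) !big_split /=.
rewrite sumrMnl -mulr_sumr => H; rewrite /ode_rel -[RHS]H.
(* The terms with R'' add up to 2m R'' times the original relation, hence vanish. *)
rewrite addrACA -mulrnDl -mulrDr E mulr0 mul0rn addr0; congr (_ + _).
(* Over the longer range the first sum gains a zero term at the top, the second one at the
   bottom. *)
transitivity (\sum_(j < m.+2) ((b`_j)^`() \Po R) * dterm m.+1 j +
   \sum_(j < m.+2) ((b * 'X)`_j \Po R) * dterm m.+1 j).
  rewrite -big_split /=; apply: eq_bigr => j _.
  by rewrite coefD coef_map_id0 ?deriv0// comp_polyD mulrDl.
congr (_ + _).
  by rewrite big_ord_recr /= [b`_m.+1]nth_default// deriv0 comp_poly0 mul0r addr0.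
rewrite big_ord_recl coefMX /= comp_poly0 mul0r add0r.
by apply: eq_bigr => j _; rewrite coefMX.
Qed.

Lemma ode_exists n : size R = n.+1 -> (0 < n)%N -> R^`() != 0 ->
  exists (b : {poly {poly F}}) (c : {poly F}) (m : nat),
    [/\ size b = n, (n <= m.+1)%N & ode_rel b c m].
Proof.
move=> sR n0 R'0.
(* The last entry is the constant function 1 over the common denominator; its coefficient becomes
   the inhomogeneous term. *)
pose M (i : 'I_n.+1) := if (i < n)%N then dterm n.-1 i else R^`() ^+ n.-1.*2.
have [b [[i bi] bM]] := poly_comp_dependence M sR.
pose B := \poly_(j < n) b (inord j).
have relB : ode_rel B (b ord_max) n.-1.
  rewrite /ode_rel prednK// -[RHS]bM big_ord_recr /= /M /= ltnn; congr (_ + _).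
  apply: eq_bigr => j _; rewrite ltn_ord coef_poly ltn_ord; congr ((b _ \Po R) * _).
  by apply: val_inj; rewrite /= inordK// ltnS ltnW.
have B0 : B != 0.
  apply: contraTneq bi => BE; rewrite negbK.
  have bz (j : 'I_n) : b (widen_ord (leqnSn n) j) = 0.
    have := congr1 (fun p : {poly {poly F}} => p`_j) BE.
    rewrite coef_poly coef0 ltn_ord => <-; congr b.
    by apply: val_inj; rewrite /= inordK// ltnS ltnW.
  (* Only c(R) R'^(2n-2) = 0 is left, and c(R) = 0 forces c = 0 because [R] is not constant. *)
  have bmax : b ord_max = 0.
    move: relB; rewrite /ode_rel big1 ?add0r => [|j _].
      move=> /eqP; rewrite mulf_eq0 expf_eq0 (negPf R'0) andbF orbF => /eqP h.
      by apply/eqP; rewrite -(comp_poly_eq0 _ (q := R)) ?h// sR ltnS.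
    by rewrite BE coef0 comp_poly0 mul0r.
  case: (unliftP ord_max i) => [j ->|->]; last by rewrite bmax.
  by rewrite -(bz j); apply/eqP; congr b; apply: val_inj; rewrite /= /bump leqNgt ltn_ord.
have [k kE] : exists k, (n = k + size B)%N.
  by exists (n - size B)%N; rewrite subnK// size_poly.
(* Here [k] counts differentiations. Each one also raises the exponent of the common denominator, so
   [m] can exceed [n.-1]. *)
suff : forall k, exists (b : {poly {poly F}}) (c : {poly F}) m,
    [/\ size b = (k + size B)%N, (k + size B <= m.+1)%N & ode_rel b c m].
  by move=> /(_ k); rewrite -kE.
elim=> [|l [b' [c [m [sb lm rel]]]]].
  exists B, (b ord_max), n.-1; split=> //; rewrite prednK//; exact: size_poly.
exists (ode_diff b'), c^`(), m.+1; split=> //.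
- by rewrite size_ode_diff ?sb// -size_poly_gt0 sb addn_gt0 size_poly_gt0 B0 orbT.
- by apply: ode_diff_rel rel; rewrite sb.
Qed.

End Derivatives.

(** * Calculus for complex-valued functions of a real variable *)

Section RcomplexDerivatives.
Variable K : realType.
Implicit Types (f g : K -> Rcomplex K) (q : K).

Lemma Rcomplex_normrM (z w : Rcomplex K) : `|(z * w : Rcomplex K)| = `|z| * `|w|.
Proof. exact: Normc.normcM. Qed.

Lemma Rcomplex_scaleE (a : K) (z : Rcomplex K) : a *: z = a%:C%C * z.
Proof.
by case: z => u v; congr (_ +i* _)%C; rewrite mul0r ?subr0 ?addr0.
Qed.

Lemma Rcomplex_scale1 (a : K) : a *: (1 : Rcomplex K) = a%:C%C.
Proof. by rewrite Rcomplex_scaleE mulr1. Qed.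

(** Squeeze by |fg - ab| <= |f - a| |g| + |a| |g - b|, using that the norm is multiplicative. *)
Lemma Rcomplex_cvgM {T : Type} (F : set_system T) (FF : Filter F)
    (f g : T -> Rcomplex K) (a b : Rcomplex K) :
  f @ F --> a -> g @ F --> b -> (fun t => f t * g t) @ F --> a * b.
Proof.
move=> fa gb; apply/subr_cvg0/norm_cvg0P.
have fa0 : `|f t - a| @[t --> F] --> (0 : K) by apply/norm_cvg0P/subr_cvg0.
have gb0 : `|g t - b| @[t --> F] --> (0 : K) by apply/norm_cvg0P/subr_cvg0.
have ub : `|f t - a| * `|g t| + `|a| * `|g t - b| @[t --> F] --> (0 : K).
  have gn : `|g t| @[t --> F] --> `|b| by exact: cvg_norm.
  have an : `|a| @[t --> F] --> `|a| by exact: cvg_cst.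
  by have := cvgD (cvgM fa0 gn) (cvgM an gb0); rewrite mul0r mulr0 addr0; exact.
apply: (squeeze_cvgr _ (cvg_cst 0) ub); apply: nearW => t.
rewrite normr_ge0 -!Rcomplex_normrM /=.
rewrite (_ : f t * g t - a * b = (f t - a) * g t + a * (g t - b) :> Rcomplex K) ?ler_normD//.
by ring.
Qed.

Lemma Rcomplex_is_deriveM f g q (df dg : Rcomplex K) :
  is_derive q 1 f df -> is_derive q 1 g dg ->
  is_derive q 1 (fun p => f p * g p) (df * g q + f q * dg).
Proof.
move=> [fd <-] [gd <-].
suff : (fun h : K => h^-1 *: (((fun p => f p * g p) \o shift q) (h *: 1)
    - f q * g q)) @ 0^' --> 'D_1 f q * g q + f q * 'D_1 g q.
  by move=> L; apply: DeriveDef; [apply/cvg_ex; eexists; exact: L|exact: cvg_lim L].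
(* In this splitting [g] is taken at the moved point, so its continuity at [q] is required; it
   follows from differentiability. *)
rewrite (_ : (fun h : K => _) = (fun h : K =>
    (h^-1 *: (f (h *: 1 + q) - f q)) * g (h *: 1 + q)
    + f q * (h^-1 *: (g (h *: 1 + q) - g q)))); last first.
  apply/funext => h /=; rewrite !Rcomplex_scaleE; ring.
apply: cvgD; apply: Rcomplex_cvgM; [exact: fd| |exact: cvg_cst|exact: gd].
suff : {for 0, continuous (fun h : K => g (h *: 1 + q))}.
  by move=> /continuous_withinNx; rewrite scale0r add0r.
exact/differentiable_continuous/derivable1_diffP/(derivable1P _ _ _).1.
Qed.

Lemma Rcomplex_is_derive_scale1 (f : K -> K) q (df : K) :
  is_derive q 1 f df -> is_derive q 1 (fun p => f p *: (1 : Rcomplex K)) (df *: 1).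
Proof.
move=> [/derivable1_diffP fd <-]; apply: DeriveDef.
  exact/derivable1_diffP/differentiableZl.
by rewrite !deriveE ?diffZl//; exact: differentiableZl.
Qed.

(** Constants become real multiples of 1, and the map is a ring morphism in [P], so polynomial
    identities transfer to values at [z]. *)
Definition Rcomplex_eval (z : Rcomplex K) (P : {poly K}) : Rcomplex K :=
  (map_poly (in_alg (Rcomplex K)) P).[z].

HB.instance Definition _ z := GRing.RMorphism.copy (Rcomplex_eval z)
  (horner_eval z \o map_poly (in_alg (Rcomplex K))).

Lemma Rcomplex_evalC z c : Rcomplex_eval z c%:P = c *: 1.
Proof. by rewrite /Rcomplex_eval map_polyC hornerC. Qed.

Lemma Rcomplex_evalX z : Rcomplex_eval z 'X = z.
Proof. by rewrite /Rcomplex_eval map_polyX hornerX. Qed.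

(** Applied on a branch with [Q] equal to [R], it turns b_j(R(x)) into the real scalar b_j(q). *)
Lemma Rcomplex_eval_comp z P Q (a : K) : Rcomplex_eval z Q = a *: 1 ->
  Rcomplex_eval z (P \Po Q) = P.[a] *: 1.
Proof.
rewrite /Rcomplex_eval map_comp_poly horner_comp => ->.
by rewrite -[a *: 1]/(in_alg (Rcomplex K) a) horner_map.
Qed.

Lemma Rcomplex_eval_real (u : K) (P : {poly K}) :
  Rcomplex_eval (u *: 1) P = P.[u] *: 1.
Proof. by rewrite -[u *: 1]/(in_alg (Rcomplex K) u) /Rcomplex_eval horner_map. Qed.

Lemma Rcomplex_is_derive_eval f q (df : Rcomplex K) (P : {poly K}) :
  is_derive q 1 f df ->
  is_derive q 1 (fun p => Rcomplex_eval (f p) P) (Rcomplex_eval (f q) P^`() * df).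
Proof.
move=> fd; elim/poly_ind: P => [|P c IH].
  under eq_fun do rewrite rmorph0.
  by rewrite deriv0 rmorph0 mul0r; exact: is_derive_cst.
under eq_fun do rewrite rmorphD rmorphM /= Rcomplex_evalX Rcomplex_evalC.
have D := is_deriveD (Rcomplex_is_deriveM IH fd)
  (is_derive_cst (c *: (1 : Rcomplex K)) q 1).
apply: (is_derive_eq D); rewrite derivD derivM derivX derivC !addr0 mulr1.
by rewrite rmorphD rmorphM /= Rcomplex_evalX; ring.
Qed.

Lemma Rcomplex_eval_map (z : Rcomplex K) (P : {poly K}) :
  (map_poly (real_complex K) P).[z] = Rcomplex_eval z P.
Proof.
congr horner; apply: eq_map_poly => a /=.
by rewrite Rcomplex_scale1.
Qed.

Lemma times_differentiable_leq (V : normedModType K) j k (x : K -> V) q :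
  (j <= k)%N -> times_differentiable k x q -> times_differentiable j x q.
Proof.
elim: k => [|k IH]; first by rewrite leqn0 => /eqP ->.
rewrite leq_eqVlt => /predU1P[-> //|] jk [/nbhs_singleton xq _].
exact: IH.
Qed.

(* Real branches are handled as complex ones through this embedding. *)
Lemma Rcomplex_times_differentiable_scale1 (x : K -> K) q k :
  times_differentiable k x q ->
  times_differentiable k (fun p => x p *: (1 : Rcomplex K)) q /\
  (fun p => x p *: (1 : Rcomplex K))^`(k)%classic q = x^`(k)%classic q *: 1.
Proof.
elim: k q => [//|k IH] q [xq dxq].
have D := Rcomplex_is_derive_scale1 (derivableP dxq).
have {}D : is_derive q 1 (fun p => x p *: (1 : Rcomplex K))^`(k)%classic
    ('D_1 x^`(k)%classic q *: 1).
  (* The induction hypothesis holds on a whole neighborhood of [q], so the two k-th derivatives may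
     be differentiated alike. *)
  apply: near_eq_is_derive D; near do apply/esym; apply: filterS xq => p.
  by case/IH.
split; first split; first by apply: filterS xq => p /IH [].
  by case: D.
by rewrite !derive1nS !derive1E; case: D.
Unshelve. all: by end_near. Qed.

(** * Derivatives along a branch of roots *)

Section RootBranch.
Variables (R : {poly K}) (U : set K) (x : K -> Rcomplex K).
Hypothesis Uo : open U.
Hypothesis Rx : forall p, U p -> Rcomplex_eval (x p) R = p *: 1.

(** Chain rule on R(x(p)) = p, valid near [q] as [U] is open. In particular R'(x(q)) is nonzero
    wherever x is differentiable. *)
Lemma root_branch_derive q : U q -> derivable x q 1 ->
  Rcomplex_eval (x q) R^`() * 'D_1 x q = 1.
Proof.
move=> Uq dx; have [_ <-] := Rcomplex_is_derive_eval R (derivableP dx).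
have [_ D] := Rcomplex_is_derive_scale1 (is_derive_id q (1 : K)).
rewrite -[RHS]scale1r -D; apply: near_eq_derive.
by apply: filterS (open_nbhs_nbhs (conj Uo Uq)) => p /Rx.
Qed.

(** By induction the identity holds near [q], so both sides can be differentiated there. *)
Lemma root_branch_derive1n j q : U q -> times_differentiable j x q ->
  x^`(j)%classic q * Rcomplex_eval (x q) R^`() ^+ j.*2 = Rcomplex_eval (x q) (dnum R j).
Proof.
elim: j q => [|j IH] q Uq; first by rewrite /= expr0 mulr1 Rcomplex_evalX.
move=> td; have [tdj dxj] := td.
have [_ dx] : times_differentiable 1 x q by exact: times_differentiable_leq td.
have Dx := root_branch_derive Uq dx.
have E := IH _ Uq (nbhs_singleton tdj).
pose S := R^`() ^+ j.*2.
have [_ DL] := Rcomplex_is_deriveM (derivableP dxj)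
  (Rcomplex_is_derive_eval S (derivableP dx)).
have [_ DR] := Rcomplex_is_derive_eval (dnum R j) (derivableP dx).
have {DL DR} DE : 'D_1 x^`(j)%classic q * Rcomplex_eval (x q) S
    + x^`(j)%classic q * (Rcomplex_eval (x q) S^`() * 'D_1 x q)
    = Rcomplex_eval (x q) (dnum R j)^`() * 'D_1 x q.
  rewrite -DL -DR; apply: near_eq_derive.
  near=> p; rewrite rmorphXn; apply: IH; near: p => //.
  exact: open_nbhs_nbhs.
rewrite derive1nS derive1E /=; move: DE; rewrite /S deriv_exp.
rewrite rmorphB !rmorphMn !rmorphM !rmorphXn /= -{}E; move: Dx.
set r := Rcomplex_eval (x q) R^`(); set v := 'D_1 x q => rv DE.
have {}DE : 'D_1 x^`(j)%classic q * r ^+ j.*2 = Rcomplex_eval (x q) (dnum R j)^`() * v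
    - x^`(j)%classic q * (Rcomplex_eval (x q) R^`()^`() * r ^+ j.*2.-1 *+ j.*2 * v).
  by rewrite -DE addrK.
(* Of the two new factors r = R'(x), one cancels v = x'; the result is the recursion defining
   [dnum]. *)
rewrite doubleS (_ : _ * r ^+ _ = ('D_1 x^`(j)%classic q * r ^+ j.*2) * (r * r));
  last by rewrite !exprS; ring.
rewrite DE mulrBl; congr (_ - _).
  by rewrite mulrA mulrAC -(mulrA _ v) (mulrC v) rv mulr1.
(* For j = 0 the exponent [j.*2.-1] is truncated, but its term carries the factor 0. *)
move: rv; case: (j.*2) => [|k]; first by rewrite !mulr0n mul0r mulr0 mul0r.
rewrite -pred_Sn => rv; transitivity ((r * v) * (x^`(j)%classic q * r ^+ k.+1 *
  Rcomplex_eval (x q) R^`()^`() *+ k.+1)); last by rewrite rv mul1r.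
by rewrite exprS; ring.
Unshelve. all: by end_near. Qed.
End RootBranch.
End RcomplexDerivatives.

(** * From the polynomial identity to the differential equation *)

(** Evaluate the identity at x(q) and cancel R'(x(q))^(2m), which is nonzero because n >= 2 provides
    a first derivative. *)
Lemma root_branch_ode (K : realType) (R : {poly K}) (U : set K) (x : K -> Rcomplex K)
    (b : {poly {poly K}}) (c : {poly K}) (m n : nat) (q : K) :
  open U -> (forall p, U p -> Rcomplex_eval (x p) R = p *: 1) ->
  size b = n -> (n <= m.+1)%N -> ode_rel R b c m ->
  (1 < n)%N -> U q -> times_differentiable n.-1 x q ->
  \sum_(j < n) (b`_j).[q] *: x^`(j)%classic q + c.[q] *: 1 = 0.
Proof.
move=> Uo Rx sb nm E n1 Uq td.
have tdj j : (j < n)%N -> times_differentiable j x q.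
  move=> jn; apply: times_differentiable_leq td.
  by rewrite -ltnS prednK// ltnW.
have [_ dx] := tdj 1%N n1.
have := root_branch_derive Uo Rx Uq dx.
set r := Rcomplex_eval (x q) R^`() => rv.
have r0 : r != 0 by apply: contra_eq_neq rv => ->; rewrite mul0r eq_sym oner_eq0.
have := congr1 (Rcomplex_eval (x q)) E.
rewrite rmorph0 rmorphD rmorphM rmorphXn rmorph_sum /= -/r.
rewrite (Rcomplex_eval_comp _ (Rx q Uq)).
(* Terms of index n to m vanish since [b] has size [n]. *)
rewrite -(subnKC nm) big_split_ord /= [X in _ + X + _]big1 => [|j _]; last first.
  by rewrite nth_default ?sb ?leq_addr// comp_poly0 mul0r rmorph0.
rewrite addr0 => E'.
apply: (mulIf (expf_neq0 m.*2 r0)); rewrite mul0r mulrDl -[RHS]E'; congr (_ + _).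
rewrite mulr_suml; apply: eq_bigr => j _.
rewrite rmorphM /= (Rcomplex_eval_comp _ (Rx q Uq)) /dterm rmorphM rmorphXn /= -/r.
rewrite -(root_branch_derive1n Uo Rx Uq (tdj j (ltn_ord j))) -/r.
rewrite -[in LHS](@subnK j m); last by rewrite -ltnS (leq_trans (ltn_ord j)).
rewrite doubleD exprD !Rcomplex_scaleE; ring.
Qed.

Theorem theorem1p5 (K : realType) (R : {poly K}) (n : nat)
    (n_ge2 : (2 <= n)%N) (degR : size R = n.+1) (R0 : R.[0] = 0) :
  exists b : nat -> {poly K},
    [/\ b n.-1 != 0,
        forall (U : set K) (x : K -> K), real_root_branch R U x ->
          forall q : K, U q -> times_differentiable n.-1 x q ->
            \sum_(j < n) (b j).[q] * x^`(j)%classic q + (b n).[q] = 0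
      & forall (U : set K) (x : K -> Rcomplex K), complex_root_branch R U x ->
          forall q : K, U q -> times_differentiable n.-1 x q ->
            \sum_(j < n) (b j).[q] *: x^`(j)%classic q + ((b n).[q])%:C%C = 0].
Proof.
have n0 : (0 < n)%N by exact: ltnW.
(* In characteristic 0 the coefficient of index n-1 of R' is n times the leading coefficient of
   [R]. *)
have R'0 : R^`() != 0.
  apply: contraTneq n_ge2 => R'0; rewrite -leqNgt leqW//.
  have := coef_deriv R n.-1; rewrite R'0 coef0 prednK// => /esym/eqP.
  by rewrite mulrn_eq0 (gtn_eqF n0) /= -[n]/(n.+1.-1) -degR -lead_coefE lead_coef_eq0 -size_poly_eq0 degR.
have [b [c [m [sb nm E]]]] := ode_exists degR n0 R'0.
exists (fun j => if (j < n)%N then b`_j else c).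
rewrite ltnn (ltn_predL n) n0; split.
- by rewrite -sb -lead_coefE lead_coef_eq0 -size_poly_gt0 sb.
- move=> U x [[Uo _] _ Ux _] q Uq td.
  pose y p := x p *: (1 : Rcomplex K).
  have Ry p : U p -> Rcomplex_eval (y p) R = p *: 1.
    move=> /Ux; rewrite rootE hornerD hornerN hornerC subr_eq0 => /eqP Rp.
    by rewrite Rcomplex_eval_real Rp.
  have [tdy _] := Rcomplex_times_differentiable_scale1 td.
  have := root_branch_ode Uo Ry sb nm E n_ge2 Uq tdy.
  have dy (j : 'I_n) : y^`(j)%classic q = x^`(j)%classic q *: 1.
    have /Rcomplex_times_differentiable_scale1[] // : times_differentiable j x q.
    by apply: times_differentiable_leq td; rewrite -ltnS prednK.
  under eq_bigr => j _ do rewrite dy scalerA.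
  (* All terms are real multiples of 1, so the complex equation reduces to the real one. *)
  rewrite -scaler_suml -scalerDl => /eqP; rewrite scaler_eq0 oner_eq0 orbF => /eqP S.
  by rewrite -[RHS]S; congr (_ + _); apply: eq_bigr => j _; rewrite ltn_ord.
- move=> U x [[Uo _] _ Ux _] q Uq td.
  have Rx p : U p -> Rcomplex_eval (x p) R = p *: 1.
    move=> /Ux; rewrite rootE rmorphB /= map_polyC hornerD hornerN hornerC subr_eq0.
    by rewrite Rcomplex_eval_map => /eqP ->; rewrite Rcomplex_scale1.
  rewrite -Rcomplex_scale1 -[RHS](root_branch_ode Uo Rx sb nm E n_ge2 Uq td).
  by congr (_ + _); apply: eq_bigr => j _; rewrite ltn_ord.
Qed.
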